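(* Let $q$ be an odd prime power, $\delta\in\mathbb{F}_{q^2}$ and $\gamma\in\mathbb{F}_q^*$. Then the polynomial $$f(x)=(x^q-x+\delta)^{4q+2}+\gamma(x^q+x)$$ is a permutation polynomial of $\mathbb{F}_{q^2}$ if and only if $q\equiv0\pmod 5$ and $\mathrm{Tr}_q^{q^2}(\delta)\neq0$.
   Context: A polynomial over a finite field $\mathbb{F}$ is a permutation polynomial of $\mathbb{F}$ if the map it induces on $\mathbb{F}$ is a bijection. For $x\in\mathbb{F}_{q^2}$, $\mathrm{Tr}_q^{q^2}(x)=x+x^q$.
   Formalization: The case q = 3 is excluded: the claim fails there, e.g. over F_9 with δ = γ = 1 the polynomial f is a permutation polynomial although 3 is not ≡ 0 mod 5. *)

(* Defs.v *)
From HB Require Import structures.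
From mathcomp Require Import all_boot all_order all_algebra all_field.
Set Implicit Arguments.
Unset Strict Implicit.
Unset Printing Implicit Defensive.
Import GRing.Theory.
Local Open Scope ring_scope.

Definition odd_prime_power (q : nat) : Prop :=
  odd q /\ exists p k : nat, [/\ prime p, (0 < k)%N & q = (p ^ k)%N].

Definition permutation_poly (F : finFieldType) (f : {poly F}) : Prop :=
  bijective (fun x : F => f.[x]).

(* The trace from the field with q ^ 2 elements to its subfield with q
   elements, computed in the larger field. *)
Definition Tr (F : finFieldType) (q : nat) (x : F) : F := x + x ^+ q.

(* Main.v *)
(* Put t = Tr delta, z = x^q - x + delta and w = z - z^q.  Then
   f(x)^q - f(x) = t w (t^2 - w^2)^2 / 16, and w runs over eps * F_q for a fixed
   eps with eps^q = - eps; so for t <> 0, f permutes F_(q^2) iff the quintic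
   P(u) = u (u^2 - a)^2 permutes F_q, where a = t^2 / eps^2 is a nonsquare.
   In characteristic 5 this is seen by factoring P(u) - P(v).  Otherwise a
   collision of P amounts to a rational function of one parameter taking a
   nonzero square value; if there is none, Euler's criterion makes a polynomial
   of degree at most q - 1 vanish on F_q^*, and its coefficients of low degree
   give a contradiction as soon as q > 3. *)
Require Import Defs.
From HB Require Import structures.
From mathcomp Require Import all_boot all_order all_algebra all_field.
From mathcomp Require Import fingroup cyclic.
From mathcomp Require Import zify ring.
Set Implicit Arguments.
Unset Strict Implicit.
Unset Printing Implicit Defensive.
Import GRing.Theory.
Local Open Scope ring_scope.

(** * Polynomials and squares over a finite field *)

Lemma natf_eq0_card (F : finFieldType) (p k r : nat) :
  prime p -> (0 < k)%N -> #|F| = (p ^ k)%N -> prime r ->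
  (r%:R == 0 :> F) = (r %| #|F|)%N.
Proof.
move=> p_pr k_gt0 cardF r_pr.
rewrite -(dvdn_pcharf (card_finPcharP cardF p_pr)) cardF Euclid_dvdX // k_gt0 andbT.
by rewrite !dvdn_prime2 // eq_sym.
Qed.

(** The coefficient of X is the derivative at 0, so this is the power rule. *)
Lemma coef1_exp (R : comNzRingType) (p : {poly R}) (n : nat) :
  (p ^+ n)`_1 = p`_1 * p`_0 ^+ n.-1 *+ n.
Proof.
have coef1E (r : {poly R}) : r`_1 = r^`().[0] by rewrite horner_coef0 coef_deriv.
by rewrite !coef1E deriv_exp hornerMn hornerM horner_exp !horner_coef0.
Qed.

(* Such a polynomial is a multiple of X^(q-1) - 1. *)
Lemma coef_eq0_of_roots_unit (F : finFieldType) (T : {poly F}) (i : nat) :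
  (size T <= #|F|)%N -> (forall x, x != 0 -> T.[x] = 0) ->
  (0 < i < #|F|.-1)%N -> T`_i = 0.
Proof.
move=> sizeT T0 /andP[i_gt0 lt_i].
(* Subtracting this multiple kills the coefficient of degree q - 1, so [U] has degree below q - 1
   but vanishes at the q - 1 nonzero elements. *)
pose U := T - T`_(#|F|.-1) *: ('X^(#|F|.-1) - 1).
have cardF_gt0 : (0 < #|F|.-1)%N by apply: leq_ltn_trans lt_i.
have UE j : U`_j = T`_j - T`_(#|F|.-1) * ((j == #|F|.-1)%:R - (j == 0)%:R).
  by rewrite coefB coefZ coefB coefXn coef1.
have U0 : U = 0.
  apply: (@roots_geq_poly_eq0 _ _ (enum (predC1 (0 : F)))).
  - apply/allP=> x; rewrite mem_enum inE => x_neq0; apply/rootP.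
    rewrite !hornerE T0 // -[x ^+ _]mulr1 -(divff x_neq0) mulrA.
    rewrite -exprSr prednK ?expf_card ?(ltnW cardF_gt0) //.
      by rewrite divff // subrr mulr0 subrr.
    by rewrite (leq_trans cardF_gt0) ?leq_pred.
  - exact: enum_uniq.
  rewrite -cardE cardC1; apply/leq_sizeP => j le_j; rewrite UE.
  have [->|neq_j] := eqVneq j #|F|.-1.
    by rewrite eqn0Ngt cardF_gt0 subr0 mulr1 subrr.
  rewrite nth_default ?sub0r; last first.
    apply: leq_trans sizeT _; rewrite -(prednK (leq_trans cardF_gt0 (leq_pred _))).
    by rewrite ltn_neqAle eq_sym neq_j.
  rewrite eqn0Ngt (leq_trans cardF_gt0) //=.
  by rewrite mulr0n oppr0 mulr0 oppr0.
have := UE i; rewrite U0 coef0 (ltn_eqF lt_i) eqn0Ngt i_gt0 subrr mulr0 subr0.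
by move/esym.
Qed.

Lemma pow_half_sq (F : finFieldType) (m : nat) (x : F) :
  #|F| = m.*2.+1 -> x != 0 -> (x ^+ m) ^+ 2 = 1.
Proof.
move=> cardF x_neq0; apply: (mulfI x_neq0).
by rewrite mulr1 -exprM muln2 -exprS -cardF expf_card.
Qed.

(** A nonzero x is a power g^i of a generator g of order 2m; x^m = 1 makes 2m divide i m, so i is
    even. *)
Lemma euler_criterion (F : finFieldType) (m : nat) (x : F) :
  #|F| = m.*2.+1 -> x != 0 -> reflect (exists y, x = y ^+ 2) (x ^+ m == 1).
Proof.
move=> cardF x_neq0; apply: (iffP eqP) => [xm1 | [y xE]]; last first.
  rewrite xE exprAC (pow_half_sq cardF) //.
  by apply: contraNneq x_neq0 => y0; rewrite xE y0 expr0n.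
have [g gE] := cyclicP (field_unit_group_cyclic [set: {unit F}]%G).
have ux : x \is a GRing.unit by rewrite unitfE.
have : FinRing.unit F ux \in <[g]>%g by rewrite -gE inE.
case/cycleP=> i xg; have xE : x = val g ^+ i by rewrite -FinRing.val_unitX -xg.
have ord_g : #[g]%g = m.*2 by rewrite orderE -gE card_finField_unit cardF.
have m_gt0 : (0 < m)%N by have := order_gt0 g; rewrite ord_g double_gt0.
have : (#[g]%g %| i * m)%N.
  by rewrite order_dvdn; apply/eqP/val_inj; rewrite FinRing.val_unitX FinRing.val_unit1 exprM -xE.
rewrite ord_g -mul2n dvdn_pmul2r // => /dvdnP[j iE].
by exists (val g ^+ j); rewrite -exprM -iE.
Qed.

Lemma euler_nonsquare (F : finFieldType) (m : nat) (x : F) :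
  #|F| = m.*2.+1 -> (forall y, x != y ^+ 2) -> x ^+ m = -1.
Proof.
move=> cardF nsq_x.
have x_neq0 : x != 0 by have := nsq_x 0; rewrite expr0n.
have /eqP := pow_half_sq cardF x_neq0; rewrite sqrf_eq1 => /orP[|/eqP//].
by case/(euler_criterion cardF x_neq0) => y /eqP; rewrite (negPf (nsq_x y)).
Qed.

(** The cardinality 2m + 1 is zero in F, so m = 0 in F would give 1 = 0. *)
Lemma half_card_neq0 (F : finFieldType) (m : nat) :
  #|F| = m.*2.+1 -> m%:R != 0 :> F.
Proof.
move=> cardF; have : #|F|%:R = 0 :> F.
  have := expg_cardG (in_setT (1 : F)); rewrite cardsT.
  by rewrite FinRing.zmodXgE FinRing.zmod1gE.
apply: contra_eq_neq => m0; rewrite cardF -addn1 -addnn !natrD m0 !add0r.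
exact: oner_neq0.
Qed.

(** * The quintic: injectivity in characteristic 5, collisions otherwise *)

Definition quintic (F : nzRingType) (a u : F) : F := u * (u ^+ 2 - a) ^+ 2.

Lemma quintic_inj_char5 (F : fieldType) (a : F) :
  5%:R = 0 :> F -> 2%:R != 0 :> F -> (forall y, a != y ^+ 2) ->
  injective (quintic a).
Proof.
move=> five0 two_neq0 nsq_a u v /eqP; rewrite -subr_eq0.
pose s := u + v; pose p := u * v.
have -> : quintic a u - quintic a v =
    (u - v) * (p ^+ 2 + (2%:R * a - 3%:R * s ^+ 2) * p + (s ^+ 2 - a) ^+ 2).
  by rewrite /quintic /s /p; ring.
rewrite mulf_eq0 subr_eq0 => /orP[/eqP//|/eqP G0].
(* In characteristic 5 the discriminant of the second factor, a quadratic in p,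
   is a * s ^+ 2. *)
have disc : (2%:R * p + 2%:R * a - 3%:R * s ^+ 2) ^+ 2 = a * s ^+ 2.
  transitivity (4%:R * (p ^+ 2 + (2%:R * a - 3%:R * s ^+ 2) * p + (s ^+ 2 - a) ^+ 2)
      + 5%:R * (s ^+ 4 - a * s ^+ 2) + a * s ^+ 2); first by ring.
  by rewrite G0 five0 mulr0 mul0r !add0r.
(* If s were nonzero, dividing [disc] by s^2 would exhibit a as a square. *)
have s0 : s = 0.
  apply: contraTeq isT => s_neq0.
  have := nsq_a ((2%:R * p + 2%:R * a - 3%:R * s ^+ 2) / s).
  by rewrite expr_div_n disc mulfK ?expf_neq0 ?eqxx.
(* Now p = - u^2, and [disc] reduces to a = u^2, again impossible. *)
have vE : v = - u by apply/eqP; rewrite -addr_eq0 addrC -/s s0.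
move: disc; rewrite s0 !expr0n /= mulr0 subr0 mulr0 => /eqP.
rewrite expf_eq0 /= -mulrDr mulf_eq0 (negPf two_neq0) /= /p vE mulrN addrC subr_eq0.
by rewrite -expr2 (negPf (nsq_a u)).
Qed.

(* With u, u' = S +- V, the symmetric quartic (P(u) - P(u')) / (u - u') is
   quadratic in u * u'; its discriminant is a square when R exists, and V then
   comes from splitting u and u' over the field. *)
Lemma quintic_collision (F : fieldType) (a S R V : F) :
  2%:R != 0 :> F -> R ^+ 2 = 5%:R * S ^+ 2 - a ->
  V ^+ 2 = - (R * (R + 2%:R * S)) -> injective (quintic a) -> V = 0.
Proof.
move=> two_neq0 R2 V2 inj.
have aE : a = 5%:R * S ^+ 2 - R ^+ 2 by rewrite R2; ring.
suff /inj E : quintic a (S + V) = quintic a (S - V).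
  apply/eqP; rewrite -(mulrI_eq0 _ (mulfI two_neq0)); apply/eqP.
  by transitivity (S + V - (S - V)); [ring | rewrite E subrr].
apply/eqP; rewrite -subr_eq0; apply/eqP.
transitivity (2%:R * V * (5%:R * S ^+ 4 + 10%:R * S ^+ 2 * V ^+ 2 + (V ^+ 2) ^+ 2
   - 2%:R * a * (3%:R * S ^+ 2 + V ^+ 2) + a ^+ 2)); first by rewrite /quintic; ring.
by rewrite V2 aE; ring.
Qed.

(* Here the conic R^2 = 5 S^2 - a is parametrised by t = R - c S. *)
Lemma quintic_not_inj_sq5 (F : finFieldType) (m : nat) (a c : F) :
  #|F| = m.*2.+1 -> (1 < m)%N -> 2%:R != 0 :> F -> 5%:R != 0 :> F ->
  5%:R = c ^+ 2 -> (forall y, a != y ^+ 2) -> ~ injective (quintic a).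
Proof.
move=> cardF m_gt1 two_neq0 five_neq0 c2 nsq_a inj.
pose D := c + 2%:R; pose K := - (c * D).
have D2 : D ^+ 2 = 4%:R * D + 1.
  by transitivity (c ^+ 2 - 5%:R + 4%:R * D + 1); [rewrite /D; ring | rewrite c2 subrr add0r].
have Dcm : D * (c - 2%:R) = 1.
  by transitivity (c ^+ 2 - 5%:R + 1); [rewrite /D; ring | rewrite c2 subrr add0r].
have four_neq0 : 4%:R != 0 :> F by rewrite (natrM _ 2 2) mulf_neq0.
have c_neq0 : c != 0 by apply: contraNneq five_neq0 => c0; rewrite c2 c0 expr0n.
have D_neq0 : D != 0.
  by apply: contraTneq isT => D0; move/eqP: Dcm; rewrite D0 mul0r eq_sym oner_eq0.
have K_neq0 : K != 0 by rewrite oppr_eq0 mulf_neq0.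
have a_neq0 : a != 0 by have := nsq_a 0; rewrite expr0n.
have ta_neq0 (t : F) : t ^+ 2 - a != 0 by rewrite subr_eq0 eq_sym nsq_a.
have tb_neq0 (t : F) : t ^+ 2 - a * D ^+ 2 != 0.
  apply: contraNneq (ta_neq0 (t / D)) => /eqP; rewrite subr_eq0 => /eqP tE.
  by rewrite expr_div_n tE mulfK ?subrr ?expf_neq0.
(* This product is V^2 times the square of 2 c D t, simplified with c - 2 = 1 / D; a square value
   would give a collision with V nonzero. *)
have nsq (t : F) : t != 0 -> forall y, K * (t ^+ 2 - a) * (t ^+ 2 - a * D ^+ 2) != y ^+ 2.
  move=> t_neq0 y; apply/eqP => yE.
  have V0 : y / (2%:R * c * D * t) = 0.
    apply: (@quintic_collision F a (- ((a / t + t) / (2%:R * c)))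
      ((t - a / t) / 2%:R)) => //.
      rewrite c2; field.
      by rewrite c_neq0 two_neq0 t_neq0.
    rewrite expr_div_n -yE.
    transitivity (- ((t ^+ 2 - a) * (D * (c - 2%:R) * t ^+ 2 - a * D ^+ 2)) /
                  (2%:R ^+ 2 * c * D * t ^+ 2)).
      by rewrite Dcm /K; field; rewrite c_neq0 four_neq0 two_neq0 D_neq0 t_neq0.
    transitivity (- ((t ^+ 2 - a) * ((c - 2%:R) * t ^+ 2 - a * D)) /
                  (2%:R ^+ 2 * c * t ^+ 2)).
      by field; rewrite c_neq0 four_neq0 ?two_neq0 D_neq0 t_neq0.
    by rewrite /D; field; rewrite c_neq0 ?four_neq0 two_neq0 t_neq0.
  move/eqP: V0; rewrite mulf_eq0 invr_eq0 !mulf_eq0 (negPf two_neq0) (negPf c_neq0).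
  rewrite (negPf D_neq0) (negPf t_neq0) !orbF => /eqP y0.
  by move/eqP: yE; rewrite y0 expr0n !mulf_eq0 (negPf K_neq0) (negPf (ta_neq0 t))
    (negPf (tb_neq0 t)).
pose e := - K ^+ m.
have e2 : e ^+ 2 = 1 by rewrite sqrrN (pow_half_sq cardF).
(* The m-th powers of nonzero elements are 1 or -1, so Euler's criterion for [nsq] reads (t^2 - a
   D^2)^m = e (t^2 - a)^m. *)
pose T := ('X - (a * D ^+ 2)%:P) ^+ m - e *: ('X - a%:P) ^+ m.
have T0 (t : F) : t != 0 -> (T \Po 'X^2).[t] = 0.
  move=> t_neq0; rewrite horner_comp /T !(hornerD, hornerN, hornerZ, horner_exp, hornerX, hornerC).
  have := euler_nonsquare cardF (nsq t t_neq0); rewrite !exprMn => E.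
  apply/eqP; rewrite subr_eq0; apply/eqP.
  transitivity ((K ^+ m) ^+ 2 * ((t ^+ 2 - a) ^+ m) ^+ 2 * (t ^+ 2 - a * D ^+ 2) ^+ m).
    by rewrite !(pow_half_sq cardF) // !mul1r.
  transitivity (K ^+ m * (t ^+ 2 - a) ^+ m *
    (K ^+ m * (t ^+ 2 - a) ^+ m * (t ^+ 2 - a * D ^+ 2) ^+ m)); first by ring.
  by rewrite E /e; ring.
(* T(X^2) has degree at most 2m = q - 1, and index 2 lies strictly below q - 1 because m > 1. *)
have T1 : T`_1 = 0.
  have <- : (T \Po 'X^2)`_2 = T`_1 by rewrite coef_comp_poly_Xn.
  apply: coef_eq0_of_roots_unit => //; last by rewrite cardF; lia.
  apply: leq_trans (size_comp_poly_leq _ _) _; rewrite size_polyXn cardF /= muln2.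
  rewrite ltnS leq_double; apply: (@leq_trans m.+1.-1) => //; rewrite -!subn1 leq_sub2r //.
  rewrite (leq_trans (size_polyD _ _)) // geq_max size_exp_XsubC leqnn /= size_polyN.
  by rewrite (leq_trans (size_scale_leq _ _)) // size_exp_XsubC.
have m_neq0 : m%:R != 0 :> F by apply: half_card_neq0.
(* The linear coefficient of [T] gives D^(2(m-1)) = e; multiply by D^2 and use D^(2m) = 1. *)
have De : D ^+ 2 = e.
  have := T1; rewrite coefB coefZ !coef1_exp !coefB !coefX !coefC /= !subr0 !sub0r !mul1r.
  rewrite mulrnAr -mulrnBl -mulr_natl => /eqP.
  rewrite mulf_eq0 (negPf m_neq0) subr_eq0 -mulNr exprMn mulrC => /eqP.
  have na_neq0 : (- a) ^+ m.-1 != 0 by rewrite expf_neq0 ?oppr_eq0.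
  move/(mulIf na_neq0) => Dm.
  have De1 : D ^+ 2 * e = 1.
    by rewrite -Dm -exprS prednK ?(ltnW m_gt1) // exprAC (pow_half_sq cardF).
  by rewrite -[RHS]mul1r -De1 -mulrA -expr2 e2 mulr1.
(* With D^2 = 4 D + 1, the value 1 forces 4 D = 0, while -1 forces 2 D = -1, hence 1 = 4 D^2 = -4
   and 5 = 0. *)
have : (D ^+ 2 == 1) || (D ^+ 2 == -1) by rewrite De -sqrf_eq1 e2.
case/orP => /eqP D2E.
  have : 2%:R * 2%:R * D = 0.
    by transitivity (4%:R * D + 1 - 1); [ring | rewrite -D2 D2E subrr].
  by move/eqP; rewrite !mulf_eq0 (negPf two_neq0) (negPf D_neq0).
have h : 2%:R * D = -1.
  apply: (mulfI two_neq0).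
  by transitivity (4%:R * D + 1 - 1); [ring | rewrite -D2 D2E; ring].
move/eqP: five_neq0; apply.
transitivity (4%:R - 4%:R * (-1 : F) - 3%:R); first by ring.
rewrite -D2E; transitivity (4%:R - (2%:R * D) ^+ 2 - 3%:R); first by ring.
by rewrite h; ring.
Qed.

(* When 5 is not a square, a = 5 b^2 and the conic R^2 = 5 S^2 - a is
   parametrised by x through its point (R, S) = (0, b). *)
Lemma quintic_not_inj_nonsq5 (F : finFieldType) (m : nat) (a : F) :
  #|F| = m.*2.+1 -> (1 < m)%N -> 2%:R != 0 :> F ->
  (forall y : F, 5%:R != y ^+ 2) -> (forall y, a != y ^+ 2) ->
  ~ injective (quintic a).
Proof.
move=> cardF m_gt1 two_neq0 nsq5 nsq_a inj.
have five_neq0 : 5%:R != 0 :> F by have := nsq5 0; rewrite expr0n.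
have a_neq0 : a != 0 by have := nsq_a 0; rewrite expr0n.
have [b a5E] : exists b, a / 5%:R = b ^+ 2.
  apply/(euler_criterion cardF); first by rewrite mulf_neq0 ?invr_eq0.
  by rewrite expr_div_n (euler_nonsquare cardF nsq_a) (euler_nonsquare cardF nsq5) divrr ?unitrN1.
have aE : a = 5%:R * b ^+ 2 by rewrite -a5E mulrC divfK.
have b_neq0 : b != 0 by apply: contraNneq a_neq0 => b0; rewrite aE b0 expr0n mulr0.
pose g (x : F) := x ^+ 2 - 5%:R * x + 5%:R.
(* The discriminant of [g] is 5, a nonsquare. *)
have g_neq0 (x : F) : g x != 0.
  apply: contraNneq (nsq5 (2%:R * x - 5%:R)) => gx0.
  rewrite -subr_eq0; apply/eqP; transitivity (- (4%:R * g x)); first by rewrite /g; ring.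
  by rewrite gx0 mulr0 oppr0.
have d_neq0 (x : F) : 5%:R - x ^+ 2 != 0 by rewrite subr_eq0 (nsq5 x).
(* Along the parametrisation, V^2 is 5 x g(x) times the square of 2 b / (5 - x^2). *)
have nsq (x : F) : x != 0 -> forall y, 5%:R * x * g x != y ^+ 2.
  move=> x_neq0 y; apply/eqP => yE.
  have V0 : 2%:R * b * y / (5%:R - x ^+ 2) = 0.
    apply: (@quintic_collision F a (b * (5%:R + x ^+ 2) / (5%:R - x ^+ 2))
      (- (10%:R * b * x / (5%:R - x ^+ 2)))) => //.
      by rewrite aE; field.
    by rewrite expr_div_n exprMn -yE /g; field.
  move/eqP: V0; rewrite !mulf_eq0 invr_eq0 (negPf two_neq0) (negPf b_neq0).
  rewrite (negPf (d_neq0 x)) orbF => /eqP y0; move/eqP: yE.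
  by rewrite y0 expr0n !mulf_eq0 (negPf five_neq0) (negPf x_neq0) (negPf (g_neq0 x)).
pose G : {poly F} := 'X^2 - 5%:R *: 'X + (5%:R)%:P.
have G0 : G`_0 = 5%:R by rewrite coefD coefB coefZ coefC coefX coefXn /= mulr0 subrr add0r.
have G1 : G`_1 = - 5%:R.
  by rewrite coefD coefB coefZ coefC coefX coefXn /= mulr1 addr0 sub0r.
(* Since 5^m = -1, Euler's criterion leaves x^m g(x)^m = 1, where x^m is its own inverse. *)
have T0 (x : F) : x != 0 -> (G ^+ m - 'X^m).[x] = 0.
  move=> x_neq0.
  rewrite !(hornerD, hornerN, hornerZ, horner_exp, hornerXn, hornerX, hornerC) -/(g x).
  have := euler_nonsquare cardF (nsq x x_neq0).
  rewrite !exprMn (euler_nonsquare cardF nsq5) !mulN1r mulNr => /oppr_inj xg.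
  apply/eqP; rewrite subr_eq0 -[_ ^+ m]mul1r -(pow_half_sq cardF x_neq0).
  by rewrite expr2 -mulrA xg mulr1.
have : (G ^+ m - 'X^m)`_1 = 0.
  apply: coef_eq0_of_roots_unit => //; last by rewrite cardF; lia.
  have sizeG : (size G <= 3)%N.
    rewrite (leq_trans (size_polyD _ _)) // geq_max (leq_trans (size_polyC_leq1 _)) //.
    rewrite andbT (leq_trans (size_polyD _ _)) // geq_max size_polyXn size_polyN.
    by rewrite (leq_trans (size_scale_leq _ _)) // size_polyX.
  rewrite cardF (leq_trans (size_polyD _ _)) // geq_max size_polyN size_polyXn.
  apply/andP; split; last by lia.
  apply: leq_trans (size_poly_exp_leq _ _) _; rewrite ltnS -mul2n leq_mul //.
  by rewrite -subn1 leq_subLR.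
(* As m > 1, X^m does not reach the linear coefficient, which is - m 5^m and hence nonzero. *)
rewrite coefB coef1_exp G0 G1 coefXn (ltn_eqF m_gt1) subr0 -mulr_natl => /eqP.
rewrite !mulf_eq0 (negPf (half_card_neq0 cardF)) oppr_eq0 (negPf five_neq0) /=.
by rewrite expf_eq0 (negPf five_neq0) andbF.
Qed.

(** Whether 5 is a square decides which parametrisation of the conic R^2 = 5 S^2 - a is
    available. *)
Lemma five_eq0_of_quintic_inj (F : finFieldType) (m : nat) (a : F) :
  #|F| = m.*2.+1 -> (1 < m)%N -> 2%:R != 0 :> F ->
  (forall y, a != y ^+ 2) -> injective (quintic a) -> 5%:R = 0 :> F.
Proof.
move=> cardF m_gt1 two_neq0 nsq_a inj; apply/eqP.
have [//|five_neq0] := eqVneq (5%:R : F) 0; exfalso.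
have /eqP := pow_half_sq cardF five_neq0; rewrite sqrf_eq1 => /orP[].
  move=> /(euler_criterion cardF five_neq0)[c c2].
  exact: (quintic_not_inj_sq5 cardF m_gt1 two_neq0 five_neq0 c2 nsq_a inj).
move/eqP=> five_m; apply: (quintic_not_inj_nonsq5 cardF) inj => // y.
apply: contraTneq isT => yE.
have y_neq0 : y != 0 by apply: contraNneq five_neq0 => y0; rewrite yE y0 expr0n.
move/eqP: five_m; rewrite yE exprAC (pow_half_sq cardF) // -subr_eq0 opprK.
by rewrite (negPf two_neq0).
Qed.

(** * Descent from the large field to the quintic over the subfield *)

(** X^q - X is the product of all X - y over F, and [iota] carries this factorisation to L. *)
Lemma frobenius_fixed_image (F L : finFieldType) (iota : {rmorphism F -> L}) (x : L) :
  x ^+ #|F| = x -> exists y, x = iota y.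
Proof.
move=> xq; have : root (map_poly iota (\prod_(y : F) ('X - y%:P))) x.
  rewrite -finField_genPoly rmorphB /= map_polyXn map_polyX.
  by rewrite rootE !hornerE xq subrr.
rewrite rmorph_prod rootE horner_prod => /prodf_eq0[y _].
by rewrite rmorphB /= map_polyX map_polyC -rootE root_XsubC => /eqP; exists y.
Qed.

(* f(x)^q - f(x) determines x^q - x through the quintic; the remaining
   freedom, translating x by the subfield, moves f additively by 2 gamma. *)
Lemma permutation_iff_quintic_inj (Fq Fq2 : finFieldType) (p k : nat)
    (iota : {rmorphism Fq -> Fq2}) (delta : Fq2) (gamma : Fq) :
  let q := (p ^ k)%N in prime p -> #|Fq| = q -> #|Fq2| = (q ^ 2)%N ->
  2%:R != 0 :> Fq -> gamma != 0 ->
  let f := ('X^q - 'X + delta%:P) ^+ (4 * q + 2) + (iota gamma)%:P * ('X^q + 'X) in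
  exists a : Fq, (forall y, a != y ^+ 2) /\
    (permutation_poly f <-> Tr q delta != 0 /\ injective (quintic a)).
Proof.
move=> q p_pr cardFq cardFq2 two_neq0 gamma_neq0 f.
have two_neq0' : 2%:R != 0 :> Fq2 by rewrite -(rmorph_nat iota) fmorph_eq0.
have q_gt1 : (1 < q)%N by rewrite -cardFq finNzRing_gt1.
have frobD (x y : Fq2) : (x + y) ^+ q = x ^+ q + y ^+ q.
  have pcharF : p \in [pchar Fq2] by apply: (@card_finPcharP _ p (k * 2)); rewrite ?expnM.
  by apply: exprDn_pchar; rewrite (eq_pnat _ (pcharf_eq pcharF)) pnatX pnat_id.
have frobN (x : Fq2) : (- x) ^+ q = - x ^+ q.
  by apply/eqP; rewrite -addr_eq0 -frobD addNr expr0n gtn_eqF // ltnW.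
have frobK (x : Fq2) : (x ^+ q) ^+ q = x.
  by rewrite -exprM mulnn -cardFq2 expf_card.
have frob_iota y : iota y ^+ q = iota y by rewrite -rmorphXn -cardFq expf_card.
have [x0 x0q] : exists x0 : Fq2, x0 ^+ q != x0.
  apply/existsP; rewrite -[[exists _, _]]negbK negb_exists; apply/negP => /forallP fixed.
  have : (#|Fq2| <= #|Fq|)%N.
    rewrite -(card_codom (fmorph_inj iota)); apply/subset_leq_card/subsetP => x _.
    have /eqP := negbNE (fixed x); rewrite -{1}cardFq => /(@frobenius_fixed_image _ _ iota)[y ->].
    exact: codom_f.
  by rewrite cardFq2 cardFq leqNgt -[X in (X < _)%N]expn1 ltn_exp2l.
pose eps := x0 ^+ q - x0.
have eps_q : eps ^+ q = - eps by rewrite frobD frobN frobK opprB.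
have eps_neq0 : eps != 0 by rewrite subr_eq0.
have [n epsE] : exists n, eps ^+ 2 = iota n.
  by apply: frobenius_fixed_image; rewrite cardFq exprAC eps_q sqrrN.
have n_neq0 : n != 0 by rewrite -(fmorph_eq0 iota) -epsE expf_neq0.
(* Otherwise [eps] would be plus or minus [iota y], hence fixed by Frobenius, which negates it. *)
have nsq_n y : n != y ^+ 2.
  apply/eqP => nE; move/eqP: epsE; rewrite nE rmorphXn eqf_sqr.
  have eps_iota y' : eps = iota y' -> False.
    move=> e; move: eps_q; rewrite e frob_iota -e => /eqP.
    by rewrite -addr_eq0 -mulr2n -mulr_natl mulf_eq0 (negPf two_neq0') (negPf eps_neq0).
  by case/orP=> /eqP; rewrite -?rmorphN; apply: eps_iota.
have [t tE] : exists t, Tr q delta = iota t.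
  by apply: frobenius_fixed_image; rewrite cardFq /Tr frobD frobK addrC.
have fE x : f.[x] = (x ^+ q - x + delta) ^+ (4 * q + 2) + iota gamma * (x ^+ q + x).
  by rewrite /f !(hornerD, hornerN, hornerM, horner_exp, hornerXn, hornerX, hornerC).
pose w x := 2%:R * (x ^+ q - x) + (delta - delta ^+ q).
have w_inj x y : w x = w y -> x ^+ q - x = y ^+ q - y.
  by move/addIr/(mulfI two_neq0').
have w_q x : w x ^+ q = - w x.
  rewrite /w frobD exprMn -(rmorph_nat iota) frob_iota !frobD !frobN !frobK rmorph_nat.
  by ring.
have w_eps x : exists u, w x = eps * iota u.
  have [|u uE] := @frobenius_fixed_image _ _ iota (w x / eps).
    by rewrite cardFq expr_div_n w_q eps_q invrN mulrNN.
  by exists u; rewrite -uE mulrC divfK.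
have eps_w u : exists x, w x = eps * iota u.
  (* [y] is the value required of x^q - x; as y^q = - y, the choice x = - y / 2 attains it. *)
  pose y := (eps * iota u - (delta - delta ^+ q)) / 2%:R.
  have y_q : y ^+ q = - y.
    rewrite /y expr_div_n frobD frobN exprMn eps_q frob_iota frobD frobN frobK.
    by rewrite -(rmorph_nat iota) frob_iota rmorph_nat; field.
  exists (- y / 2%:R).
  rewrite /w expr_div_n frobN y_q opprK -(rmorph_nat iota) frob_iota rmorph_nat /y.
  by field.
have f_frob x u : w x = eps * iota u ->
    f.[x] ^+ q - f.[x] = eps * iota (t * n ^+ 2 / 16%:R * quintic (t ^+ 2 / n) u).
  move=> wE; have [z zdef] : exists z, z = x ^+ q - x + delta by eexists.
  have zt : z + z ^+ q = iota t by rewrite -tE zdef /Tr !frobD frobN frobK; ring.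
  have zw : z - z ^+ q = eps * iota u by rewrite -wE /w zdef !frobD frobN frobK; ring.
  (* The [gamma] term is fixed by Frobenius and cancels; on z^(4q+2) Frobenius swaps z and z^q. *)
  have -> : f.[x] ^+ q - f.[x] = z ^+ 4 * (z ^+ q) ^+ 2 - (z ^+ q) ^+ 4 * z ^+ 2.
    rewrite fE -zdef exprD [(4 * q)%N]mulnC exprM frobD !exprMn frob_iota frobD.
    by rewrite !frobK; ring.
  have zE : z = (iota t + eps * iota u) / 2%:R by rewrite -zt -zw; field.
  have zqE : z ^+ q = (iota t - eps * iota u) / 2%:R by rewrite -zt -zw; field.
  rewrite zqE zE /quintic.
  rewrite !(rmorphM, rmorphB, rmorphXn, fmorphV, rmorph_nat) /= -epsE.
  by field; rewrite eps_neq0 two_neq0' (natrX _ 2 4) expf_neq0.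
have [t0|t_neq0] := eqVneq t 0.
  (* For trace zero all values of [f] are fixed by Frobenius, so [x0] is never attained; any
     nonsquare serves as a. *)
  exists n; split=> //; rewrite tE t0 rmorph0 eqxx; split=> [|[]//] [g fg gf].
  exfalso; have [u uE] := w_eps (g x0).
  have /eqP := f_frob _ _ uE; rewrite gf t0 !mul0r rmorph0 mulr0 subr_eq0.
  by rewrite (negPf x0q).
exists (t ^+ 2 / n); split=> [y|].
  apply: contraNneq (nsq_n (t / y)) => tn.
  have y_neq0 : y != 0.
    apply: contraTneq isT => y0; move/eqP: tn.
    by rewrite y0 expr0n mulf_eq0 invr_eq0 expf_eq0 (negPf t_neq0) (negPf n_neq0).
  by rewrite expr_div_n -tn invf_div mulrC divfK ?expf_neq0.
have sixteen_neq0 : 16%:R != 0 :> Fq by rewrite (natrX _ 2 4) expf_neq0.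
have coef_neq0 : t * n ^+ 2 / 16%:R != 0 by rewrite !mulf_neq0 ?invr_eq0 ?expf_neq0.
have gamma_iota_neq0 : iota gamma != 0 by rewrite fmorph_eq0.
rewrite tE fmorph_eq0 t_neq0; split=> [[g fg gf]|[_ inj]].
  split=> // u v uv.
  have [x xu] := eps_w u; have [y yv] := eps_w v.
  have fxy : f.[x] ^+ q - f.[x] = f.[y] ^+ q - f.[y].
    by rewrite (f_frob _ _ xu) (f_frob _ _ yv) uv.
  have [b bE] : exists b, f.[x] - f.[y] = iota b.
    apply: frobenius_fixed_image; rewrite cardFq frobD frobN.
    by rewrite -[f.[x] ^+ q](subrK f.[x]) fxy; ring.
  (* Translating by [c] keeps x^q - x and adds 2 gamma c = b to [f], so x and y + c have the same
     image. *)
  pose c := iota (b / (2%:R * gamma)).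
  have wc : (y + c) ^+ q - (y + c) = y ^+ q - y by rewrite frobD frob_iota; ring.
  have fc : f.[y + c] = f.[x].
    rewrite -[f.[x]](subrK f.[y]) bE !fE wc frobD frob_iota.
    rewrite /c fmorph_div rmorphM rmorph_nat; field.
    by rewrite gamma_iota_neq0.
  have xE : x = y + c by rewrite -[x]fg -[y + c]fg fc.
  apply: (fmorph_inj iota); apply: (mulfI eps_neq0).
  by rewrite -xu -yv /w xE wc.
apply: injF_bij => x y fxy.
have [u uE] := w_eps x; have [v vE] := w_eps y.
have uv : u = v.
  apply/inj/(mulfI coef_neq0)/(fmorph_inj iota)/(mulfI eps_neq0).
  by rewrite -(f_frob _ _ uE) -(f_frob _ _ vE) fxy.
have xyq : x ^+ q - x = y ^+ q - y by apply: w_inj; rewrite uE uv vE.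
move/eqP: fxy; rewrite !fE xyq (inj_eq (addrI _)) => /eqP/(mulfI gamma_iota_neq0) tr.
apply: (mulfI two_neq0').
transitivity (x ^+ q + x - (x ^+ q - x)); first by ring.
by rewrite xyq tr; ring.
Qed.

(* q = 3 has to be excluded: over F_9, with delta = gamma = 1, the polynomial
   is a permutation polynomial although 5 does not divide 3. *)
Theorem theorem3p16 (q : nat) (hq : odd_prime_power q) (q_neq3 : q != 3%N)
    (Fq Fq2 : finFieldType) (cardFq : #|Fq| = q) (cardFq2 : #|Fq2| = (q ^ 2)%N)
    (iota : {rmorphism Fq -> Fq2})
    (delta : Fq2) (gamma : Fq) (gamma_neq0 : gamma != 0) :
  permutation_poly (('X^q - 'X + delta%:P) ^+ (4 * q + 2)
                    + (iota gamma)%:P * ('X^q + 'X))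
  <-> (q = 0 %[mod 5])%N /\ Tr q delta != 0.
Proof.
case: hq => q_odd [p [k [p_pr k_gt0 qE]]].
rewrite {q}qE in q_odd q_neq3 cardFq cardFq2 *.
have natF := natf_eq0_card p_pr k_gt0 cardFq.
have two_neq0 : 2%:R != 0 :> Fq by rewrite natF // cardFq dvdn2 q_odd.
have cardE : #|Fq| = (p ^ k)./2.*2.+1 by rewrite cardFq -[LHS]odd_double_half q_odd.
(* Here q = 3 is excluded: the half of an odd q > 1 is 1 only for q = 3. *)
have half_gt1 : (1 < (p ^ k)./2)%N.
  have := finNzRing_gt1 Fq; rewrite cardE -ltnS.
  by move: q_neq3; rewrite -cardFq cardE; case: _./2 => [|[]].
have five_eq0 : ((p ^ k) = 0 %[mod 5])%N <-> 5%:R = 0 :> Fq.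
  split=> [q5|/eqP]; first by apply/eqP; rewrite natF // cardFq /dvdn q5.
  by rewrite natF // cardFq => /eqP.
have [a [nsq_a ->]] :=
  permutation_iff_quintic_inj iota delta p_pr cardFq cardFq2 two_neq0 gamma_neq0.
rewrite five_eq0; split=> [[tr inj]|[five0 tr]]; split=> //.
  exact: (five_eq0_of_quintic_inj cardE half_gt1 two_neq0 nsq_a inj).
exact: quintic_inj_char5.
Qed.
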